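(* Let $R'$ be a commutative $\mathbb{Z}[\rho]$-algebra, let $h: R_0=\mathbb{Z}[\rho][u] \to R'$ be any $\mathbb{Z}[\rho]$-algebra homomorphism, and set $a = h(u)$. Then the image $Z^p + g(Z) - a \in R'[Z]$ of the polynomial $Z^p+g(Z)-u$ under $h$ is separable over $R'$ if and only if $1 + a\eta^p$ is invertible in $R'$. In particular, with $R = R_0[1/(1+u\eta^p)]$ and $T = R[Z]/(Z^p+g(Z)-u)$, the extension $T/R$ is Galois with group generated by $\sigma$, where $\sigma$ is the $R$-algebra automorphism of $T$ (of order $p$) with $\sigma(\theta) = \rho\theta+1$, $\theta$ being the image of $Z$ in $T$.
   Context: $p$ is a prime, $\rho$ is a primitive $p$-th root of one, $\mathbb{Z}[\rho]=\mathbb{Z}[X]/(X^{p-1}+\cdots+1)$, and $\eta=\rho-1$. There is a unit $\xi\in\mathbb{Z}[\rho]^*$ with $p=\xi\eta^{p-1}$. Put $b_i=\binom{p}{i}/p$ for $1\le i\le p-1$ and $g(Z)=\xi\sum_{i=1}^{p-1} b_i\eta^{i-1}Z^i\in\mathbb{Z}[\rho][Z]$; thus $(1+\eta Z)^p=1+\eta^p(Z^p+g(Z))$. In a $\mathbb{Z}[\rho]$-algebra, $\rho,\eta$ and the coefficients of $g$ denote their images. A monic polynomial $f\in R'[Z]$ is separable if $R'[Z]/(f)$ is a separable $R'$-algebra (equivalently, its discriminant is a unit). ''Galois'' is in the sense of Galois extensions of commutative rings (Auslander–Goldman, Chase–Harrison–Rosenberg). *)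

(* Defs.v *)
From mathcomp Require Import all_boot all_order all_algebra all_fingroup.
From mathcomp Require Import qpoly.

Set Implicit Arguments.
Unset Strict Implicit.
Unset Printing Implicit Defensive.

Import GRing.Theory.
Local Open Scope ring_scope.

Definition invertible (R : comNzRingType) (x : R) : Prop :=
  exists y : R, x * y = 1.

(* R is R0[1/s]: its elements are the fractions x / s^n, and x / 1 = y / 1
   iff s^k x = s^k y for some k. *)
Definition is_localization_away (R0 R : comNzRingType)
    (f : {rmorphism R0 -> R}) (s : R0) : Prop :=
  [/\ invertible (f s),
      (forall r : R, exists (x : R0) (n : nat), r * f s ^+ n = f x)
    & (forall x y : R0, f x = f y <-> exists n : nat, s ^+ n * x = s ^+ n * y)].

Section SeparableAlgebra.
Variables (R : comNzRingType) (A : algType R).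

(* A left module over the enveloping algebra of A (the tensor product over R
   of A and its opposite), where a (x) b acts by m |-> a m b. [ract_central]
   says that the two R-module structures on M coincide. *)
Record envModule := EnvModule {
  env_lmod :> lmodType A;
  ract : env_lmod -> A -> env_lmod;
  ractDl : forall m n a, ract (m + n) a = ract m a + ract n a;
  ractDr : forall m a b, ract m (a + b) = ract m a + ract m b;
  ract1 : forall m, ract m 1 = m;
  ractM : forall m a b, ract m (a * b) = ract (ract m a) b;
  ract_lact : forall a m b, ract (a *: m) b = a *: ract m b;
  ract_central : forall m (r : R), ract m r%:A = r%:A *: m
}.

Definition env_hom (M N : envModule) (f : M -> N) : Prop :=
  linear f /\ forall m a, f (ract m a) = ract (f m) a.

Definition env_projective (P : envModule) : Prop :=
  forall (M N : envModule) (f : M -> N) (g : P -> N),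
    env_hom f -> env_hom g -> (forall n, exists m, f m = n) ->
    exists2 h : P -> M, env_hom h & forall x, f (h x) = g x.

Fact regular_central (m : A^o) (r : R) : (m : A) * r%:A = (r%:A : A) *: m.
Proof. by rewrite (mulr_algr r (m : A)) -(mulr_algl r (m : A)). Qed.

Definition env_regular : envModule :=
  @EnvModule A^o (fun m a => (m : A) * a)
    (fun m n a => mulrDl (m : A) n a) (fun m a b => mulrDr (m : A) a b)
    (fun m => mulr1 (m : A)) (fun m a b => mulrA (m : A) a b)
    (fun a m b => esym (mulrA a (m : A) b)) regular_central.

Definition separable_algebra : Prop := env_projective env_regular.

End SeparableAlgebra.

(* [{poly %/ f}] is R[Z]/(f) only for f monic of degree at least 1: otherwise
   the library replaces f by 'X. *)
Definition monic_separable (R : comNzRingType) (f : {poly R}) : Prop :=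
  f \is monic /\ separable_algebra {poly %/ f}.

(* Galois extensions as in Chase-Harrison-Rosenberg: R embeds in S, S^G = R
   and there are x_i, y_i in S with \sum_i x_i g(y_i) = delta_(1, g). *)
Definition galois_action (R : comNzRingType) (S : comAlgType R)
    (G : finGroupType) (to : {action G &-> S}) : Prop :=
  [/\ (forall g : G, linear (to^~ g) /\ monoid_morphism (to^~ g)),
      (forall g : G, (forall t : S, to t g = t) -> g = 1%g),
      injective (in_alg S),
      (forall t : S, (forall g : G, to t g = t) <-> exists r : R, t = r%:A)
    & exists (n : nat) (x y : 'I_n -> S), forall g : G,
        \sum_(i < n) x i * to (y i) g = (g == 1%g)%:R].

Section KummerPolynomial.
Variable p : nat.

Definition Phi : {poly int} := \sum_(i < p) 'X^i.

(* Z[rho]; for p prime, Phi is monic of positive degree. *)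
Local Notation Zrho := {poly %/ Phi}.

Definition rhop : Zrho := 'qX.
Definition etap : Zrho := rhop - 1.

Definition g_poly (xi : Zrho) : {poly Zrho} :=
  xi *: \sum_(1 <= i < p) (('C(p, i) %/ p)%:R * etap ^+ i.-1) *: 'X^i.

Definition kummer_poly (xi : Zrho) (A : comAlgType Zrho) (a : A) : {poly A} :=
  'X^p + map_poly (in_alg A) (g_poly xi) - a%:P.

Definition kummer_unit (A : comAlgType Zrho) (a : A) : A :=
  1 + a * (etap ^+ p)%:A.

End KummerPolynomial.

Notation Zrho p := {poly %/ Phi p}.

(* Main.v *)
(* Everything rests on two polynomial identities, for F = Z^p + g(Z):
     (1 + eta Z)^p = 1 + eta^p F(Z)   and   F'(Z) = xi (1 + eta Z)^(p-1).
   Put w = 1 + eta theta in T = R'[Z]/(F - a).  Then w^p = 1 + a eta^p and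
   f'(theta) = xi w^(p-1), so f'(theta) is invertible iff 1 + a eta^p is, and it
   remains to see that R'[Z]/(f) is separable iff f'(theta) is invertible.

   Since 1 + eta (rho Z + 1) = rho (1 + eta Z), rho^p = 1 and eta is not a zero
   divisor, F(rho Z + 1) = F(Z); this gives sigma.  Its powers satisfy
   sigma^i theta - theta = (1 + rho + ... + rho^(i-1)) w, a cyclotomic unit
   times w.  Hence the conjugates of theta have invertible differences, and
   Lagrange interpolation at them yields both the Galois coordinates and
   T^sigma = R. *)
Require Import Defs.
From HB Require Import structures.
From mathcomp Require Import all_boot all_order all_algebra all_fingroup.
From mathcomp Require Import qpoly.
From mathcomp Require Import ring.

Set Implicit Arguments.
Unset Strict Implicit.
Unset Printing Implicit Defensive.

Import GRing.Theory.
Local Open Scope ring_scope.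

(** * Invertible elements, and polynomials with separated roots *)

Section Invertible.
Variable R : comNzRingType.
Implicit Types x y : R.

Lemma invertible1 : invertible (1 : R).
Proof. by exists 1; rewrite mulr1. Qed.

Lemma invertibleM x y : invertible (x * y) <-> invertible x /\ invertible y.
Proof.
split=> [[z xyz]|[[x' xx'] [y' yy']]]; last first.
  by exists (x' * y'); rewrite mulrACA xx' yy' mulr1.
split; first by exists (y * z); rewrite mulrA.
by exists (x * z); rewrite mulrCA mulrA.
Qed.

Lemma invertibleX x n : (0 < n)%N -> invertible (x ^+ n) <-> invertible x.
Proof.
case: n => // n _; elim: n => [|n IHn]; first by rewrite expr1.
by rewrite exprS invertibleM IHn; split=> [[]|].
Qed.

Lemma invertible_prod (I : Type) (r : seq I) (P : pred I) (F : I -> R) :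
  (forall i, P i -> invertible (F i)) -> invertible (\prod_(i <- r | P i) F i).
Proof.
move=> invF; elim/big_ind: _ => // [|x y *]; first exact: invertible1.
by rewrite invertibleM.
Qed.

Lemma invertible_rmorph (S : comNzRingType) (phi : {rmorphism R -> S}) x :
  invertible x -> invertible (phi x).
Proof. by case=> y xy; exists (phi y); rewrite -rmorphM xy rmorph1. Qed.

Lemma invertible_lreg x y : invertible x -> x * y = 0 -> y = 0.
Proof. by case=> x' xx' xy0; rewrite -[y]mul1r -xx' mulrAC xy0 mul0r. Qed.

Lemma invertible_neq0 x : invertible x -> x != 0.
Proof.
by case=> y; apply: contra_eq_neq => ->; rewrite mul0r eq_sym oner_neq0.
Qed.

(** Invertible differences stand in for the absence of zero divisors: at the next root, the product
    already split off takes an invertible value, so the cofactor must vanish there. *)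
Lemma roots_prod_XsubC (q : {poly R}) (x : nat -> R) n :
    (forall i, (i < n)%N -> root q (x i)) ->
    (forall i j, (i < j < n)%N -> invertible (x j - x i)) ->
  exists r, q = r * \prod_(i < n) ('X - (x i)%:P).
Proof.
elim: n => [|n IHn] q0 dx; first by exists q; rewrite big_ord0 mulr1.
have [i lin|i j /andP[lij ljn]|r qE] := IHn.
- exact/q0/ltnW.
- by apply: dx; rewrite lij ltnW.
suff /factor_theorem[r' rE] : root r (x n).
  by exists r'; rewrite qE rE big_ord_recr /= -mulrA [_ * ('X - _)]mulrC.
have /rootP := q0 n (leqnn _); rewrite qE hornerM mulrC => /invertible_lreg.
move=> r0; apply/rootP/r0; rewrite horner_prod.
by apply: invertible_prod => i _; rewrite hornerXsubC; apply: dx;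
  rewrite ltnS ltn_ord /=.
Qed.

Lemma roots_eq0 (q : {poly R}) (x : nat -> R) n :
    (forall i, (i < n)%N -> root q (x i)) ->
    (forall i j, (i < j < n)%N -> invertible (x j - x i)) ->
  (size q <= n)%N -> q = 0.
Proof.
move=> q0 dx; have [r ->] := roots_prod_XsubC q0 dx.
have [->|nz_r] := eqVneq r 0; first by rewrite mul0r.
rewrite size_Mmonic ?monic_prod_XsubC // size_prod_XsubC.
by rewrite /index_enum -enumT size_enum_ord addnS /= leqNgt -subn_gt0 addnK
  size_poly_gt0 nz_r.
Qed.

End Invertible.

(** * The quotient R[Z]/(f) for monic [f]: remainders, evaluation, universal property *)

Section MonicQuotient.
Variables (R : comNzRingType) (f : {poly R}).
Hypotheses (f_monic : f \is monic) (f_gt1 : (1 < size f)%N).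
Local Notation A := {poly %/ f}.
Local Notation theta := ('qX : A).

Lemma mk_monicE : mk_monic f = f.
Proof. by rewrite /mk_monic f_gt1 f_monic. Qed.

Lemma in_qpolyK (t : A) : in_qpoly f t = t.
Proof. by apply/val_inj/in_qpoly_small; rewrite size_mk_monic. Qed.

Lemma in_qpoly_eq0P (q : {poly R}) : in_qpoly f q = 0 <-> exists r, q = r * f.
Proof.
split=> [/(congr1 val)/=|[r ->]]; last first.
  by apply/val_inj; rewrite /= mk_monicE Pdiv.RingMonic.rmodp_mull.
by rewrite mk_monicE => /Pdiv.CommonRing.rmodp_eq0P
  /(Pdiv.RingMonic.rdvdpP f_monic).
Qed.

Lemma in_qpolyC c : in_qpoly f c%:P = c%:A.
Proof. by rewrite -[c%:P]mulr1 mul_polyC linearZ /= in_qpoly1. Qed.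

Lemma in_qpolyE q : in_qpoly f q = (map_poly (in_alg A) q).[theta].
Proof.
elim/poly_ind: q => [|q c IHq]; first by rewrite !rmorph0 horner0.
rewrite !rmorphD !rmorphM /= map_polyX map_polyC !hornerE -IHq.
by rewrite in_qpolyC.
Qed.

Lemma qpoly_horner (t : A) : (map_poly (in_alg A) t).[theta] = t.
Proof. by rewrite -in_qpolyE in_qpolyK. Qed.

Lemma root_qpolyX : root (map_poly (in_alg A) f) theta.
Proof. by apply/rootP; rewrite -in_qpolyE; apply/in_qpoly_eq0P; exists 1;
  rewrite mul1r. Qed.

(** A polynomial and its remainder differ by a multiple of [f], which [Psi] kills. Maps out of the
    quotient can thus be computed on any representative. *)
Lemma rmorph_in_qpoly (S : nzRingType) (Psi : {rmorphism {poly R} -> S}) q :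
  Psi f = 0 -> Psi (in_qpoly f q) = Psi q.
Proof.
move=> Psif; rewrite /= mk_monicE.
by rewrite [q in RHS](Pdiv.RingMonic.rdivp_eq f_monic) rmorphD rmorphM /= Psif
  mulr0 add0r.
Qed.

Lemma qpoly_ind (P : A -> Prop) :
    (forall r : R, P r%:A) -> (forall t u, P t -> P u -> P (t + u)) ->
    (forall t, P t -> P (t * theta)) ->
  forall t, P t.
Proof.
move=> PC PD PX t; rewrite -(qpoly_horner t).
elim/poly_ind: (val t) => [|q c IHq].
  by rewrite rmorph0 horner0 -(scale0r 1); apply: PC.
rewrite rmorphD rmorphM /= map_polyX map_polyC !hornerE.
by apply: PD; [apply: PX | apply: PC].
Qed.

Lemma in_alg_qpoly_inj : injective (in_alg A).
Proof. by move=> r s /(congr1 val); rewrite /= !alg_polyC => /polyC_inj. Qed.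

(** For the descent to [R], compare constant coefficients in r t = 1. *)
Lemma invertible_in_alg (r : R) : invertible (r%:A : A) <-> invertible r.
Proof.
split=> [[t rt]|]; last exact: invertible_rmorph (in_alg A) r.
exists (t : {poly R})`_0; move: rt; rewrite mulr_algl.
by move/(congr1 (fun u : A => (u : {poly R})`_0)); rewrite /= coefZ coef1.
Qed.

Section Eval.
Variables (S : comAlgType R) (s : S).

(** The proof that [s] is a root is part of the term, so that the morphism instances below can
    recover it from the map. *)
Definition qpoly_eval of root (map_poly (in_alg S) f) s :=
  fun t : A => (map_poly (in_alg S) t).[s].

Hypothesis fs : root (map_poly (in_alg S) f) s.
Local Notation ev := (qpoly_eval fs).

Lemma qpoly_eval_in q : ev (in_qpoly f q) = (map_poly (in_alg S) q).[s].
Proof.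
exact: (@rmorph_in_qpoly _ (horner_eval s \o map_poly (in_alg S)) q (rootP fs)).
Qed.

Lemma qpoly_eval_linear : linear ev.
Proof.
move=> r t u; rewrite /qpoly_eval /= rmorphD /= hornerD.
by rewrite map_polyZ hornerZ /= mulr_algl.
Qed.

Lemma qpoly_eval_monoid : monoid_morphism ev.
Proof.
split=> [|t u]; first by rewrite /qpoly_eval /= rmorph1 hornerC.
rewrite -[t in LHS]in_qpolyK -[u in LHS]in_qpolyK -rmorphM qpoly_eval_in.
by rewrite rmorphM hornerM.
Qed.

HB.instance Definition _ := GRing.isLinear.Build R A S _ ev qpoly_eval_linear.
HB.instance Definition _ := GRing.isMonoidMorphism.Build A S ev
  qpoly_eval_monoid.

Lemma qpoly_evalX : ev theta = s.
Proof. by rewrite qpoly_eval_in map_polyX hornerX. Qed.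

Lemma qpoly_lrmorph_exists : exists g : {lrmorphism A -> S}, g theta = s.
Proof. by exists ev; apply: qpoly_evalX. Qed.

End Eval.

Lemma lrmorph_qpoly (S : comAlgType R) (g : {lrmorphism A -> S}) (t : A) :
  g t = (map_poly (in_alg S) t).[g theta].
Proof.
rewrite -[t in LHS]qpoly_horner -horner_map -map_poly_comp; congr _.[_].
by apply: eq_map_poly => r; rewrite /= linearZ rmorph1.
Qed.

End MonicQuotient.

(** * Separability of R[Z]/(f) and invertibility of f'(theta) *)

Section Separability.
Variables (R : comNzRingType) (f : {poly R}).
Hypotheses (f_monic : f \is monic) (f_gt1 : (1 < size f)%N).
Local Notation A := {poly %/ f}.
Local Notation theta := ('qX : A).
Local Notation fA := (map_poly (in_alg A) f).

Let fA_monic : fA \is monic. Proof. exact: monic_map. Qed.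

Let fA_gt1 : (1 < size fA)%N.
Proof. by rewrite size_map_poly_id0 // (monicP f_monic) rmorph1 oner_neq0. Qed.

Let root_theta : root fA theta. Proof. exact: root_qpolyX. Qed.

(* [{poly %/ fA}] is the tensor square of A over R; its left factor acts by
   scalars and its right factor through [ract_poly]. *)
Local Notation A2 := {poly %/ fA}.

Definition ract_poly (a : A) : A2 := in_qpoly fA (map_poly (in_alg A) a).

Lemma ract_poly_in q :
  ract_poly (in_qpoly f q) = in_qpoly fA (map_poly (in_alg A) q).
Proof.
apply: (rmorph_in_qpoly (Psi := in_qpoly fA \o map_poly (in_alg A))
  f_monic f_gt1 q).
by apply/in_qpoly_eq0P => //; exists 1; rewrite mul1r.
Qed.

Lemma ract_polyM a b : ract_poly (a * b) = ract_poly a * ract_poly b.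
Proof.
rewrite -[a in LHS]in_qpolyK -[b in LHS]in_qpolyK -rmorphM ract_poly_in.
by rewrite !rmorphM.
Qed.

Lemma ract_polyC r : ract_poly r%:A = (r%:A : A)%:A.
Proof.
by rewrite -[in LHS]in_qpolyC ract_poly_in map_polyC; apply: in_qpolyC.
Qed.

Definition tensor_square : envModule A.
Proof.
refine (@EnvModule R A A2 (fun m a => m * ract_poly a) _ _ _ _ _ _).
- by move=> m n a; rewrite mulrDl.
- by move=> m a b; rewrite /ract_poly /= rmorphD rmorphD mulrDr.
- by move=> m; rewrite /ract_poly /= rmorph1 rmorph1 mulr1.
- by move=> m a b; rewrite ract_polyM mulrA.
- by move=> a m b; rewrite scalerAl.
- by move=> m r; rewrite ract_polyC mulr_algr.
Defined.

(** A bimodule section [h] of multiplication sends 1 to an element [e] killed by X - theta. Hence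
    [e] is a multiple r B of B = f / (X - theta), and evaluating at theta gives 1 = r(theta)
    f'(theta). *)
Lemma derivative_invertible_of_separable :
  separable_algebra A -> invertible (map_poly (in_alg A) f^`()).[theta].
Proof.
(* Evaluation at [theta] is the multiplication map from the tensor square to [A]. *)
pose mul2 (m : tensor_square) : env_regular A := (m : {poly A}).[theta].
have mul2_in q : mul2 (in_qpoly fA q) = q.[theta].
  apply: (rmorph_in_qpoly (Psi := horner_eval theta) fA_monic fA_gt1).
  exact/rootP/root_theta.
case/(_ tensor_square (env_regular A) mul2 id) => //.
- split=> [a m n|m a]; first by rewrite /mul2 /= hornerD hornerZ.
  rewrite -[m in LHS]in_qpolyK /= -rmorphM mul2_in hornerM.
  by rewrite qpoly_horner.
- by move=> a; exists (in_qpoly fA a%:P); rewrite mul2_in hornerC.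
move=> h [h_lin hM] hK; pose e : A2 := h 1.
have e1 : (e : {poly A}).[theta] = 1 by apply: hK.
have /in_qpoly_eq0P[//|//|r rE] :
    in_qpoly fA (('X - theta%:P) * (e : {poly A})) = 0.
  (* Both sides are [h theta], by left and by right linearity. *)
  have: theta *: e = e * ract_poly theta.
    have := hM 1 theta; rewrite /= => <-.
    rewrite /e -(GRing.scalable_linear h_lin theta); congr (h _).
    exact: mulrC.
  have -> : ract_poly theta = in_qpoly fA 'X by rewrite ract_poly_in map_polyX.
  move=> eE; rewrite mulrBl linearB /= mul_polyC linearZ /= in_qpolyM.
  by rewrite !in_qpolyK eE mulrC subrr.
have [B BE] := factor_theorem _ _ root_theta.
have eE : (e : {poly A}) = r * B.
  by apply/(monic_rreg (monicXsubC theta)); rewrite -mulrA -BE -rE mulrC.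
exists r.[theta].
rewrite -deriv_map BE derivM derivXsubC mulr1 !hornerE subrr mulr0 add0r.
by rewrite -e1 eE hornerM mulrC.
Qed.

Lemma ract0l (M : envModule A) a : Defs.ract (0 : M) a = 0.
Proof. by apply: (@addIr _ (Defs.ract 0 a)); rewrite -ractDl !add0r. Qed.

Lemma ract0r (M : envModule A) (m : M) : Defs.ract m 0 = 0.
Proof. by apply: (@addIr _ (Defs.ract m 0)); rewrite -ractDr !add0r. Qed.

Lemma ract_sum (M : envModule A) (I : Type) (r : seq I) (F : I -> M) a :
  Defs.ract (\sum_(i <- r) F i) a = \sum_(i <- r) Defs.ract (F i) a.
Proof.
apply: (big_morph (fun m => Defs.ract m a)) => [m n|]; first exact: ractDl.
exact: ract0l.
Qed.

Lemma ract_sumr (M : envModule A) (I : Type) (r : seq I) (F : I -> A) (m : M) :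
  Defs.ract m (\sum_(i <- r) F i) = \sum_(i <- r) Defs.ract m (F i).
Proof.
apply: (big_morph (fun a => Defs.ract m a)) => [a b|]; first exact: ractDr.
exact: ract0r.
Qed.

(* With f(Y) = (\sum_j b_j Y^j) (Y - theta) over A, the element
   \sum_j b_j (x) theta^j of the enveloping algebra is killed by
   theta (x) 1 - 1 (x) theta, and multiplication sends it to f'(theta). *)
Lemma casimir_central (M : envModule A) (B : {poly A}) (m : M) (a : A) :
    fA = B * ('X - theta%:P) ->
  let e := \sum_(j < size B) Defs.ract (B`_j *: m) (theta ^+ j) in
  Defs.ract e a = a *: e.
Proof.
move=> BE; set n := size B; move=> e.
(* This is [m] acted on by f(theta) = 0; the degree of [fA] is the size of [B], hence [n.+1]
   terms. *)
have fA0 : \sum_(j < n.+1) Defs.ract (fA`_j *: m) (theta ^+ j) = 0.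
  transitivity (Defs.ract m fA.[theta]).
    rewrite (@horner_coef_wide _ n.+1) ?ract_sumr.
      by apply: eq_bigr => j _; rewrite coef_map /= ractM ract_central.
    rewrite BE size_Mmonic ?monicXsubC ?size_XsubC ?addn2 //.
    by apply: contraTneq fA_monic => B0;
      rewrite BE B0 mul0r monicE lead_coef0 eq_sym oner_neq0.
  by rewrite (rootP root_theta) ract0r.
have eX : Defs.ract e theta = theta *: e.
  (* The coefficients of [fA] are b_(j-1) - theta b_j: the first halves sum to e theta, the second
     to - theta e, and the boundary terms b_(-1) and b_n are 0. *)
  apply/eqP; rewrite -subr_eq0 -[X in _ == X]fA0; apply/eqP/esym.
  under eq_bigr => j _.
    rewrite BE mulrBr coefB coefMX coefMC scalerBl -scaleNr.
    rewrite ractDl; over.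
  rewrite big_split /=; congr (_ + _).
    rewrite big_ord_recl /= scale0r ract0l add0r /e ract_sum.
    by apply: eq_bigr => j _; rewrite exprSr ractM.
  rewrite big_ord_recr /= [B`_n]nth_default // mul0r oppr0 scale0r ract0l addr0.
  rewrite scaler_sumr -sumrN; apply: eq_bigr => j _.
  by rewrite mulrC -mulNr -scalerA ract_lact scaleNr.
(* Commuting with [theta] suffices, since it generates [A] over [R]. *)
elim/(@qpoly_ind R f): a => [r|t u et eu|t et].
- exact: ract_central.
- by rewrite ractDr et eu scalerDl.
- by rewrite mulrC ractM eX ract_lact et scalerA.
Qed.

(** Lift [g 1] to [m] and apply the Casimir element to c m, with [c] inverse to f'(theta). The
    result [e] still lies over [g 1] and is central, so x -> x e is a bimodule lift of [g]. *)
Lemma separable_of_derivative_invertible :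
  invertible (map_poly (in_alg A) f^`()).[theta] -> separable_algebra A.
Proof.
case=> c; have [B BE] := factor_theorem _ _ root_theta.
(* Differentiating f = B (Y - theta) at theta gives B(theta) = f'(theta). *)
rewrite -deriv_map BE derivM derivXsubC mulr1 !hornerE subrr mulr0 add0r => Bc.
move=> M N F g [F_lin FM] [g_lin gM] F_surj; have [m Fm] := F_surj (g 1).
pose e := \sum_(j < size B) Defs.ract (B`_j *: (c *: m)) (theta ^+ j).
have eC a : Defs.ract e a = a *: e by apply: casimir_central.
have gZ (a : A) (x : env_regular A): g (a *: x) = a *: g x.
  exact: GRing.scalable_linear.
have FZ a x : F (a *: x) = a *: F x by apply: GRing.scalable_linear.
have Fe : F e = g 1.
  have F0 : F 0 = 0 by rewrite -[X in F X](scale0r 0) FZ scale0r.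
  rewrite (big_morph F (id1 := 0) (op1 := +%R)) //; last first.
    by move=> x y; have := F_lin 1 x y; rewrite !scale1r.
  rewrite -[in RHS]Bc horner_coef mulr_suml.
  have -> : g (\sum_(j < size B) B`_j * theta ^+ j * c) =
      \sum_(j < size B) g (B`_j * theta ^+ j * c).
    apply: (big_morph g) => [x y|].
      by have := g_lin 1 x y; rewrite !scale1r.
    by rewrite -[X in g X](scale0r (0 : env_regular A)) gZ scale0r.
  apply: eq_bigr => j _.
  rewrite FM !FZ Fm -!gZ -gM; congr (g _).
  by rewrite /GRing.scale /= mulr1 mulrAC.
exists (fun x : env_regular A => (x : A) *: e) => [|x];
  last by rewrite FZ Fe -gZ /GRing.scale /= mulr1.
split=> [a x y|x a]; first by rewrite scalerDl scalerA.
by rewrite ract_lact eC scalerA.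
Qed.

End Separability.

(** * The action of a finite cyclic group by iterates *)

Section CyclicAction.
Variables (T : Type) (n : nat) (sigma : T -> T).
Hypothesis sigma_n : iter n.+1 sigma =1 id.

Lemma iter_mod_period k t : iter (k %% n.+1) sigma t = iter k sigma t.
Proof.
rewrite [in RHS](divn_eq k n.+1) addnC iterD; congr iter.
by elim: (k %/ _)%N => // q IHq; rewrite mulSn iterD -IHq sigma_n.
Qed.

(** The group law of ['I_n.+1] is addition modulo [n.+1], which the period of [sigma] absorbs. *)
Lemma iter_Zp_morph t :
  act_morph (fun t (g : 'I_n.+1) => iter g sigma t) t.
Proof. by move=> g h; rewrite -iterD addnC iter_mod_period. Qed.

Definition cyclic_action : {action 'I_n.+1 &-> T} :=
  @TotalAction _ _ (fun t (g : 'I_n.+1) => iter g sigma t) (fun=> erefl)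
    iter_Zp_morph.

Lemma cyclic_actionE t (g : 'I_n.+1) : cyclic_action t g = iter g sigma t.
Proof. by []. Qed.

End CyclicAction.

(** * Galois coordinates and invariants from separated conjugates *)

Section CyclicGalois.
Variables (R : comNzRingType) (f : {poly R}).
Hypotheses (f_monic : f \is monic) (f_gt1 : (1 < size f)%N).
Local Notation A := {poly %/ f}.
Local Notation theta := ('qX : A).
Variables (n : nat) (sigma : {lrmorphism A -> A}).
Hypothesis sigma_n : iter n.+1 sigma =1 id.
Hypothesis size_f : size f = n.+2.
Hypothesis theta_sep :
  forall i, (0 < i <= n)%N -> invertible (iter i sigma theta - theta).

(** With the next lemma, makes each iterate an algebra morphism, so that [lrmorph_qpoly] and
    [invertible_rmorph] apply to it. *)
Lemma iter_linear i : linear (iter i sigma).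
Proof. by elim: i => // i IHi a x y; rewrite !iterS IHi linearP. Qed.

Lemma iter_monoid_morphism i : monoid_morphism (iter i sigma).
Proof.
split; elim: i => // i IHi; first by rewrite iterS IHi rmorph1.
by move=> x y; rewrite !iterS IHi rmorphM.
Qed.

HB.instance Definition _ i :=
  GRing.isLinear.Build R A A _ (iter i sigma) (iter_linear i).
HB.instance Definition _ i :=
  GRing.isMonoidMorphism.Build A A (iter i sigma) (iter_monoid_morphism i).

(** The difference is the image under [iter i sigma] of the one between the conjugate of index j - i
    and [theta]. *)
Lemma orbit_sep i j :
  (i < j < n.+1)%N -> invertible (iter j sigma theta - iter i sigma theta).
Proof.
case/andP=> ij jn; rewrite -(subnKC (ltnW ij)) iterD -rmorphB.
apply: invertible_rmorph; apply: theta_sep.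
by rewrite subn_gt0 ij (leq_trans (leq_subr _ _)).
Qed.

(** Lagrange's basis polynomial at [theta]: the product over the other conjugates, divided by its
    value at [theta]. *)
Lemma orbit_interpolation : exists P : {poly A},
  forall i, (i < n.+1)%N -> P.[iter i sigma theta] = (i == 0%N)%:R.
Proof.
pose Q := \prod_(1 <= j < n.+1) ('X - (iter j sigma theta)%:P).
have [c Qc] : invertible Q.[theta].
  rewrite horner_prod big_nat_cond; apply: invertible_prod => j.
  rewrite andbT => /andP[j0 jn]; rewrite hornerXsubC -opprB.
  have [|y xy] := @theta_sep j; first by rewrite j0 -ltnS.
  by exists (- y); rewrite mulrNN.
exists (Q * c%:P) => -[|i] lin; first by rewrite hornerM hornerC Qc.
rewrite hornerM horner_prod (bigD1_seq i.+1) ?iota_uniq ?mem_index_iota //=.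
by rewrite hornerXsubC subrr !mul0r.
Qed.

Lemma cyclic_galois : galois_action (cyclic_action sigma_n).
Proof.
split.
- move=> g; split; [exact: iter_linear | exact: iter_monoid_morphism].
- move=> g /(_ theta); rewrite cyclic_actionE => gfix; apply/val_inj/eqP.
  rewrite /= -leqn0 leqNgt; apply/negP => g0.
  have /invertible_neq0 : invertible (iter g sigma theta - theta).
    by apply: theta_sep; rewrite g0 -ltnS ltn_ord.
  by rewrite gfix subrr eqxx.
- exact: in_alg_qpoly_inj.
- move=> t; split=> [tfix|[r ->] g]; last first.
    by rewrite cyclic_actionE linearZ rmorph1.
  (* The polynomial t(Y) - t has degree at most n and vanishes at all n + 1 conjugates of [theta];
     once it is 0, its constant coefficient puts [t] in [R]. *)
  have: map_poly (in_alg A) t - t%:P = 0.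
    apply: (@roots_eq0 _ _ (fun i => iter i sigma theta) n.+1).
    + move=> i lin; apply/rootP; rewrite !hornerE.
      rewrite -[X in _ - X](tfix (Ordinal lin)) cyclic_actionE /=.
      pose sigma_i : {lrmorphism A -> A} := iter i sigma.
      by rewrite [X in _ - X](lrmorph_qpoly sigma_i) subrr.
    + exact: orbit_sep.
    + rewrite (leq_trans (size_polyD _ _)) // geq_max size_polyN.
      rewrite size_polyC (leq_trans (leq_b1 _)) // andbT.
      rewrite (leq_trans (size_poly _ _)) //.
      by rewrite -ltnS -size_f (leq_trans (size_mk_monic t)) // mk_monicE.
  move/(congr1 (fun q : {poly A} => q`_0));
    rewrite coefB coef_map coefC coef0 /=.
  by move/subr0_eq => <-; exists (t : {poly R})`_0.
- have [P PE] := orbit_interpolation.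
  (* Coefficients of the Lagrange polynomial paired with powers of [theta]: the sum for [g] is P
     evaluated at the conjugate of [theta] by [g]. *)
  exists (size P), (fun i => P`_i), (fun i => theta ^+ i) => g.
  have -> : (g == 1%g) = (val g == 0%N) by [].
  rewrite -PE ?ltn_ord // horner_coef; apply: eq_bigr => i _.
  by rewrite cyclic_actionE rmorphXn.
Qed.

End CyclicGalois.

(** * The ring Z[rho] and the identities for F = Z^p + g(Z) *)

Section Kummer.
Variables (p : nat) (p_prime : prime p) (xi : Zrho p).
Hypothesis xi_eq : p%:R = xi * etap p ^+ p.-1.
Local Notation rho := (rhop p).
Local Notation eta := (etap p).

Let p_gt0 : (0 < p)%N. Proof. exact: prime_gt0. Qed.
Let p_gt1 : (1 < p)%N. Proof. exact: prime_gt1. Qed.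

Lemma Phi_poly : Phi p = \poly_(i < p) 1.
Proof. by rewrite poly_def; apply: eq_bigr => i _; rewrite scale1r. Qed.

Lemma size_Phi : size (Phi p) = p.
Proof. by rewrite Phi_poly size_poly_eq ?oner_neq0. Qed.

Lemma Phi_monic : Phi p \is monic.
Proof. by rewrite monicE Phi_poly lead_coef_poly ?oner_neq0. Qed.

Let Phi_gt1 : (1 < size (Phi p))%N. Proof. by rewrite size_Phi. Qed.

Lemma sum_rhop : \sum_(i < p) rho ^+ i = 0.
Proof.
have /(in_qpoly_eq0P Phi_monic Phi_gt1) : exists r, Phi p = r * Phi p.
  by exists 1; rewrite mul1r.
rewrite linear_sum /= => PhiE; rewrite -[RHS]PhiE.
by apply: eq_bigr => i _; rewrite rmorphXn.
Qed.

Lemma rhopX : rho ^+ p = 1.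
Proof. by apply/subr0_eq; rewrite subrX1 sum_rhop mulr0. Qed.

(* X - 1 is prime to Phi p in Z[X] because Phi p takes the value p at 1. *)
Lemma etap_lreg : GRing.lreg eta.
Proof.
apply: mulrI0_lreg => t.
have -> : eta = in_qpoly (Phi p) ('X - 1%:P) by rewrite linearB /= in_qpoly1.
rewrite -{1}[t]in_qpolyK -in_qpolyM => /(in_qpoly_eq0P Phi_monic Phi_gt1)[r rE].
have Phi1 : (Phi p).[1] = p%:R.
  rewrite horner_sum; under eq_bigr do rewrite hornerXn expr1n.
  by rewrite sumr_const card_ord.
(* At 1 the relation [rE] reads 0 = r(1) p in the integers. *)
have /factor_theorem[q qE] : root r 1.
  have /eqP := congr1 (horner^~ 1) rE.
  rewrite hornerM hornerXsubC subrr mul0r hornerM Phi1 eq_sym mulf_eq0.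
  by case/orP=> //; rewrite Num.Theory.pnatr_eq0 -leqn0 leqNgt p_gt0.
have tE : (t : {poly int}) = q * Phi p.
  by apply/(monic_rreg (monicXsubC 1)); rewrite mulrC rE qE mulrAC.
rewrite -[t]in_qpolyK; apply/(in_qpoly_eq0P Phi_monic Phi_gt1).
by exists q.
Qed.

(** The sum is (rho^i - 1)/(rho - 1). With k i = 1 modulo p, its inverse is (rho^(ik) - 1)/(rho^i -
    1): times eta, the product telescopes to rho^(ik) - 1 = eta, and eta cancels. *)
Lemma cyclotomic_unit i : (0 < i < p)%N -> invertible (\sum_(j < i) rho ^+ j).
Proof.
case/andP=> i_gt0 i_lt; have [k l kE _] := egcdnP p i_gt0.
have /eqP i_p : coprime i p by rewrite coprime_sym prime_coprime // gtnNdvd.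
exists (\sum_(j < k) (rho ^+ i) ^+ j); apply: etap_lreg.
rewrite mulrA -subrX1 -subrX1 -exprM mulnC kE i_p exprD mulnC exprM rhopX
  expr1n.
by rewrite mul1r mulr1.
Qed.

Definition kummer_base : {poly Zrho p} := 'X^p + g_poly xi.
Local Notation F := kummer_base.

(** In the binomial expansion, p b_i eta^i = eta^p xi b_i eta^(i-1) because p = xi eta^(p-1). *)
Lemma kummer_power : (1 + eta *: 'X) ^+ p = 1 + eta ^+ p *: F.
Proof.
rewrite addrC exprD1n.
rewrite -(big_mkord xpredT (fun i => (eta *: 'X) ^+ i *+ 'C(p, i))).
rewrite big_nat_recr //= big_ltn // expr0 bin0 binn !mulr1n -addrA;
  congr (1 + _).
rewrite /F scalerDr addrC exprZn; congr (_ + _).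
rewrite /g_poly !scaler_sumr; apply: eq_big_nat => i /andP[i_gt0 i_lt].
rewrite exprZn !scalerA -scaler_nat scalerA; congr (_ *: _).
rewrite -{1}(divnK (prime_dvd_bin p_prime (introT andP (conj i_gt0 i_lt)))).
have expr_pred k : (0 < k)%N -> eta ^+ k = eta * eta ^+ k.-1.
  by move=> k_gt0; rewrite -exprS prednK.
rewrite natrM xi_eq (expr_pred p) // (expr_pred i) //; ring.
Qed.

(** Coefficientwise, i b_i is the binomial coefficient of p - 1 over i - 1, and the leading
    coefficient p is xi eta^(p-1). *)
Lemma kummer_deriv : F^`() = xi *: (1 + eta *: 'X) ^+ p.-1.
Proof.
rewrite addrC exprD1n.
rewrite -(big_mkord xpredT (fun i => (eta *: 'X) ^+ i *+ 'C(p.-1, i))).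
rewrite big_nat_recr //= binn mulr1n exprZn scalerDr scalerA -xi_eq.
rewrite /F derivD derivXn addrC scaler_nat; congr (_ + _).
rewrite /g_poly derivZ; congr (_ *: _); rewrite linear_sum /= big_add1.
apply: eq_big_nat => i /= i_lt.
have i_ltp : (0 < i.+1 < p)%N by rewrite -(prednK p_gt0) ltnS.
rewrite derivZ derivXn /= exprZn -scalerMnr !scalerMnl; congr (_ *: _).
rewrite -mulrnAl -mulrnA -[RHS]mulr_natl; congr (_%:R * _).
by rewrite mulnC muln_divA ?prime_dvd_bin // -mul_bin_diag mulKn.
Qed.

Lemma kummer_base_comp : F \Po (rho *: 'X + 1) = F.
Proof.
(* As eta^p is not a zero divisor, compare after scaling by it, where [kummer_power] applies. *)
apply/subr0_eq; suff: eta ^+ p *: ((F \Po (rho *: 'X + 1)) - F) = 0.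
  move=> h; apply/polyP=> i; have /polyP/(_ i) := h.
  rewrite coefZ !coef0 => /eqP; rewrite mulrI_eq0; first by move/eqP.
  exact/lregX/etap_lreg.
rewrite scalerBr; apply/eqP; rewrite subr_eq0; apply/eqP/(addrI 1).
rewrite -kummer_power -[X in _ + X]comp_polyZ.
rewrite -[X in X + _](comp_polyC 1 (rho *: 'X + 1)).
rewrite -comp_polyD -kummer_power rmorphXn /= comp_polyD comp_polyC comp_polyZ
  comp_polyX.
have -> : 1%:P + eta *: (rho *: 'X + 1) = rho *: (1 + eta *: 'X).
  rewrite /etap !scalerDr !scalerA -!mul_polyC !rmorphM !rmorphB /= !mulr1.
  ring.
by rewrite exprZn rhopX scale1r.
Qed.

(** * The same identities at a point of any ring under Z[rho] *)

Section Specialization.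
Variables (S : comNzRingType) (psi : {rmorphism Zrho p -> S}) (s : S).

Lemma kummer_power_at :
  (1 + psi eta * s) ^+ p = 1 + psi eta ^+ p * (map_poly psi F).[s].
Proof.
(* Generalizing [F] and [eta] keeps the rewrites below from unfolding them. *)
move: F eta kummer_power => G e.
move/(congr1 (horner_eval s \o map_poly psi)).
rewrite /= /horner_eval !(rmorphXn, rmorphD, rmorph1) /= !map_polyZ map_polyX.
by rewrite !hornerE -rmorphXn.
Qed.

Lemma kummer_deriv_at :
  (map_poly psi F)^`().[s] = psi xi * (1 + psi eta * s) ^+ p.-1.
Proof.
rewrite deriv_map kummer_deriv map_polyZ rmorphXn rmorphD rmorph1 /=.
by rewrite map_polyZ map_polyX !hornerE.
Qed.

Lemma kummer_comp_at :
  (map_poly psi F).[psi rho * s + 1] = (map_poly psi F).[s].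
Proof.
rewrite -[in RHS]kummer_base_comp map_comp_poly horner_comp; congr _.[_].
by rewrite rmorphD rmorph1 /= map_polyZ map_polyX !hornerE.
Qed.

End Specialization.

End Kummer.

(** * The algebra T = R[Z]/(Z^p + g(Z) - u) and its automorphism *)

Section KummerExtension.
Variables (p : nat) (p_prime : prime p) (xi : Zrho p).
Hypothesis xi_unit : invertible xi.
Hypothesis xi_eq : p%:R = xi * etap p ^+ p.-1.
Variables (R : comAlgType (Zrho p)) (u : R).
Local Notation F := (kummer_base xi).
Local Notation f := (kummer_poly xi u).
Local Notation T := {poly %/ f}.
Local Notation theta := ('qX : T).
Local Notation iota := (in_alg T \o in_alg R).
Local Notation w := (1 + iota (etap p) * theta).

Lemma kummer_polyE : f = map_poly (in_alg R) F - u%:P.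
Proof. by rewrite /kummer_poly /kummer_base rmorphD /= map_polyXn. Qed.

Lemma map_kummer_poly (S : comAlgType R) :
  map_poly (in_alg S) f = map_poly (in_alg S \o in_alg R) F - u%:A%:P.
Proof. by rewrite kummer_polyE rmorphB /= map_polyC -map_poly_comp. Qed.

Lemma size_g_poly : (size (g_poly xi) <= p)%N.
Proof.
apply/leq_sizeP => j pj; rewrite coefZ coef_sum big_nat_cond.
rewrite big1 ?mulr0 // => i; rewrite andbT => /andP[_ ip].
by rewrite coefZ coefXn gtn_eqF ?mulr0 // (leq_trans ip).
Qed.

Let size_tail :
  (size (map_poly (in_alg R) (g_poly xi) - u%:P)%R <
     size ('X^p : {poly R})%R)%N.
Proof.
rewrite size_polyXn ltnS (leq_trans (size_polyD _ _)) // geq_max.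
rewrite size_polyN size_polyC (leq_trans (size_poly _ _) size_g_poly) /=.
by rewrite (leq_trans (leq_b1 _)) // prime_gt0.
Qed.

Lemma size_kummer_poly : size f = p.+1.
Proof. by rewrite /kummer_poly -addrA size_polyDl // size_polyXn. Qed.

Lemma kummer_poly_monic : f \is monic.
Proof. by rewrite monicE /kummer_poly -addrA lead_coefDl // lead_coefXn. Qed.

Let f_gt1 : (1 < size f)%N.
Proof. by rewrite size_kummer_poly ltnS prime_gt0. Qed.

Lemma kummer_root (s : T) :
  root (map_poly (in_alg T) f) s <-> (map_poly iota F).[s] = u%:A.
Proof.
rewrite map_kummer_poly rootE !hornerE subr_eq0.
by split=> /eqP.
Qed.

Lemma kummer_generator_root : (map_poly iota F).[theta] = u%:A.
Proof. exact/kummer_root/(root_qpolyX kummer_poly_monic f_gt1). Qed.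

Lemma kummer_generatorX : w ^+ p = (kummer_unit u)%:A.
Proof.
have wp : w ^+ p = 1 + iota (etap p) ^+ p * (map_poly iota F).[theta].
  exact: kummer_power_at.
rewrite wp kummer_generator_root -rmorphXn -[RHS]/(in_alg T (kummer_unit u)).
by rewrite /kummer_unit rmorphD rmorph1 rmorphM mulrC.
Qed.

Lemma kummer_derivative :
  (map_poly (in_alg T) f^`()).[theta] = iota xi * w ^+ p.-1.
Proof.
rewrite -deriv_map map_kummer_poly derivB derivC subr0; exact: kummer_deriv_at.
Qed.

Lemma kummer_generator_invertible : invertible w <-> invertible (kummer_unit u).
Proof.
by rewrite -(@invertible_in_alg _ f) -kummer_generatorX invertibleX ?prime_gt0.
Qed.

Lemma kummer_separable : monic_separable f <-> invertible (kummer_unit u).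
Proof.
have invD : invertible (map_poly (in_alg T) f^`()).[theta] <->
    invertible (kummer_unit u).
  (* Since p > 1, the exponent p - 1 is positive, so the power of [w] detects invertibility of
     [w]. *)
  rewrite kummer_derivative invertibleM invertibleX;
    last by rewrite -ltnS prednK ?prime_gt0 ?prime_gt1.
  rewrite -kummer_generator_invertible; split=> [[]//|inv_w]; split=> //.
  exact: (invertible_rmorph iota).
rewrite -invD; split=> [[_]|D].
  exact: (derivative_invertible_of_separable kummer_poly_monic f_gt1).
split; first exact: kummer_poly_monic.
exact: (separable_of_derivative_invertible kummer_poly_monic f_gt1).
Qed.

Lemma kummer_conjugate_root :
  root (map_poly (in_alg T) f) (iota (rhop p) * theta + 1).
Proof.
apply/kummer_root; rewrite -kummer_generator_root; exact: kummer_comp_at.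
Qed.

Variable sigma : {lrmorphism T -> T}.
Hypothesis sigmaE : sigma theta = iota (rhop p) * theta + 1.

Lemma iter_sigma_theta i :
  iter i sigma theta =
    iota (rhop p ^+ i) * theta + iota (\sum_(j < i) rhop p ^+ j).
Proof.
elim: i => [|i IHi]; first by rewrite big_ord0 rmorph0 rmorph1 mul1r addr0.
transitivity
    (iota (rhop p ^+ i) * sigma theta + iota (\sum_(j < i) rhop p ^+ j)).
  by rewrite iterS IHi rmorphD rmorphM /= !linearZ !rmorph1.
rewrite sigmaE big_ord_recr exprSr (rmorphM iota) (rmorphD iota) /=; ring.
Qed.

(** Writing rho^i = 1 + eta S with S the geometric sum, rho^i theta + S becomes theta + S (1 + eta
    theta). *)
Lemma iter_sigma_diff i :
  iter i sigma theta - theta = iota (\sum_(j < i) rhop p ^+ j) * w.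
Proof.
have rhoE : rhop p ^+ i = etap p * \sum_(j < i) rhop p ^+ j + 1.
  by rewrite -subrX1 subrK.
rewrite iter_sigma_theta rhoE (rmorphD iota) (rmorphM iota) rmorph1; ring.
Qed.

(** An algebra endomorphism is determined by its value at [theta], which is fixed because rho^p = 1
    and the p powers of rho sum to 0. *)
Lemma iter_sigma_period : iter p sigma =1 id.
Proof.
move=> t; rewrite [LHS](lrmorph_qpoly (iter p sigma : {lrmorphism T -> T})).
rewrite /= iter_sigma_theta rhopX // sum_rhop // rmorph0 rmorph1 mul1r addr0.
exact: qpoly_horner.
Qed.

Lemma kummer_theta_sep i : invertible (kummer_unit u) -> (0 < i < p)%N ->
  invertible (iter i sigma theta - theta).
Proof.
move=> inv_u i_p; rewrite iter_sigma_diff invertibleM; split.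
  exact/(invertible_rmorph iota)/cyclotomic_unit.
by rewrite kummer_generator_invertible.
Qed.

End KummerExtension.

(** * Base change along Z[rho]-algebra morphisms, and the theorem *)

Lemma map_kummer_poly_lrmorph (p : nat) (xi : Zrho p)
    (A R : comAlgType (Zrho p)) (h : {lrmorphism A -> R}) (a : A) :
  map_poly h (kummer_poly xi a) = kummer_poly xi (h a).
Proof.
rewrite !kummer_polyE rmorphB /= map_polyC -map_poly_comp; congr (_ - _).
by apply: eq_map_poly => c; rewrite /= linearZ rmorph1.
Qed.

Lemma lrmorph_kummer_unit (p : nat) (A R : comAlgType (Zrho p))
    (h : {lrmorphism A -> R}) (a : A) :
  h (kummer_unit a) = kummer_unit (h a).
Proof. by rewrite /kummer_unit rmorphD rmorph1 rmorphM /= linearZ rmorph1. Qed.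

Theorem proposition1p1 (p : nat) (p_prime : prime p) (xi : Zrho p)
    (xi_unit : invertible xi) (xi_eq : p%:R = xi * etap p ^+ p.-1) :
  (forall (R' : comAlgType (Zrho p)) (h : {lrmorphism {poly Zrho p} -> R'}),
     let a : R' := h 'X in
     let f : {poly R'} := kummer_poly xi a in
     map_poly h (kummer_poly xi ('X : {poly Zrho p})) = f /\
     (monic_separable f <-> invertible (kummer_unit a)))
  /\
  (forall (R : comAlgType (Zrho p)) (loc : {lrmorphism {poly Zrho p} -> R}),
     is_localization_away loc (kummer_unit ('X : {poly Zrho p})) ->
     let f : {poly R} := map_poly loc (kummer_poly xi ('X : {poly Zrho p})) in
     let T := {poly %/ f} in
     let theta : T := 'qX in
     exists sigma : {lrmorphism T -> T},
       [/\ bijective sigma,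
           sigma theta = ((rhop p)%:A : R)%:A * theta + 1,
           (forall tau : {lrmorphism T -> T},
              tau theta = ((rhop p)%:A : R)%:A * theta + 1 -> tau =1 sigma)
         & exists (G : finGroupType) (to : {action G &-> T}) (s : G),
             [/\ [set: G]%g = <[s]>%g, #[s]%g = p,
                 (forall t : T, to t s = sigma t)
               & galois_action to]]).
Proof.
split=> [R' h a f|R loc [inv_loc _ _]].
  by split; [apply: map_kummer_poly_lrmorph | apply: kummer_separable].
have inv_u : invertible (kummer_unit (loc 'X)) by rewrite -lrmorph_kummer_unit.
rewrite /= map_kummer_poly_lrmorph; move: (loc 'X) inv_u => u inv_u;
  set f := kummer_poly xi u.
have p_gt0 := prime_gt0 p_prime.
have f_monic : f \is monic by apply: kummer_poly_monic.
have size_f : size f = p.-1.+2 by rewrite size_kummer_poly // prednK.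
have f_gt1 : (1 < size f)%N by rewrite size_f.
have [sigma sigmaE] := qpoly_lrmorph_exists f_monic f_gt1
  (kummer_conjugate_root p_prime xi_eq u).
have sigma_p : iter p.-1.+1 sigma =1 id.
  by rewrite prednK //; apply: iter_sigma_period sigmaE.
exists sigma; split=> // [|tau tauE t|].
(* The inverse of [sigma] is its power p - 1. *)
- exists (iter p.-1 sigma) => t; first by rewrite -iterSr sigma_p.
  by rewrite -iterS sigma_p.
- by rewrite (lrmorph_qpoly tau) (lrmorph_qpoly sigma) tauE sigmaE.
(* The form [p.-1.+1] exposes the successor that the group structure on ordinals requires; [Zp1],
   the class of 1, acts as [sigma]. *)
exists 'I_p.-1.+1, (cyclic_action sigma_p), Zp1; split.
- exact: Zp_cycle.
- by rewrite order_Zp1 prednK.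
- by move=> t; rewrite cyclic_actionE iter_mod_period.
- apply: cyclic_galois => // i /andP[i_gt0 i_le].
  by apply: (kummer_theta_sep p_prime xi_eq sigmaE) => //;
    rewrite i_gt0 -ltnS prednK in i_le *.
Qed.
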